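(* For every positive integer $n$, $$B_n(q)=\det\left(q^{(i-j)^2/2}\right)_{i,j=1}^n,$$ where $B_n(q)=\sum_{w\in S_n}(-1)^{\ell(w)}q^{\beta(w)}$ is the $n$-th signed bigrassmannian polynomial.
   Context: $S_n$ is the symmetric group on $[n]=\{1,\dots,n\}$. For $w\in S_n$, the set of inversions is $N(w)=\{(i,j)\in[n]\times[n]\mid i<j \text{ and } w^{-1}(i)>w^{-1}(j)\}$, the length is $\ell(w)=|N(w)|$, and the bigrassmannian statistic is $\beta(w)=\sum_{(i,j)\in N(w)}(j-i)$. Here $q^{1/2}$ is an indeterminate, $q=(q^{1/2})^2$, and $q^{m/2}=(q^{1/2})^m$ for integers $m$; the determinant is the usual determinant of a matrix with entries in the field $\mathbf{C}(q^{1/2})$ of complex rational functions in $q^{1/2}$. *)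

(* Defs.v *)
From mathcomp Require Import all_boot all_order all_fingroup all_algebra.
From mathcomp Require Import reals complex.

Set Implicit Arguments.
Unset Strict Implicit.
Unset Printing Implicit Defensive.

Import GRing.Theory.
Local Open Scope ring_scope.
Local Open Scope complex_scope.

(* [n] = {1, ..., n} is represented by 'I_n = {0, ..., n - 1}: inversions and
   the differences of indices are unchanged by this shift. *)
Definition inversions n (w : 'S_n) : {set 'I_n * 'I_n} :=
  [set p : 'I_n * 'I_n | (p.1 < p.2)%N && ((w^-1)%g p.1 > (w^-1)%g p.2)%N].

Definition perm_length n (w : 'S_n) : nat := #|inversions w|.

Definition bigrassmannian_stat n (w : 'S_n) : nat :=
  (\sum_(p in inversions w) (p.2 - p.1))%N.

(* B_n(x), for x in any ring. *)
Definition signed_bigrassmannian (K : nzRingType) (n : nat) (x : K) : K :=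
  \sum_(w : 'S_n) (-1) ^+ perm_length w * x ^+ bigrassmannian_stat w.

(* The field C(q^(1/2)), where C = R[i] and the indeterminate q^(1/2) is 'X. *)
Definition Cqhalf (R : realType) : fieldType := {fraction {poly R[i]}}.

Definition qhalf (R : realType) : Cqhalf R := tofrac ('X : {poly R[i]}).

Definition q (R : realType) : Cqhalf R := qhalf R ^+ 2.

(* q^(m/2) *)
Definition qpow_half (R : realType) (m : int) : Cqhalf R := qhalf R ^ m.

(* Main.v *)
(* Put v = w^-1. Collecting the terms of beta(w) by index, index a occurs
   #{b < a : v b > v a} - #{b > a : v b < v a} = a - v a times, so
   beta(w) = sum_a a (a - v a), and since v permutes the indices
   2 beta(w) = sum_a (a - v a)^2. Hence the term of w in B_n is the term of v in
   the Leibniz expansion of the determinant. *)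
Require Import Defs.
From mathcomp Require Import all_boot all_order all_fingroup all_algebra.
From mathcomp Require Import reals.
From mathcomp Require Import ring.

Import GRing.Theory Num.Theory.

Local Open Scope ring_scope.

Lemma mem_inversions n (w : 'S_n) (p : 'I_n * 'I_n) :
  (p \in inversions w) = (p.1 < p.2)%N && ((w^-1)%g p.2 < (w^-1)%g p.1)%N.
Proof. by rewrite inE. Qed.

Lemma Vandermonde_col_perm (K : comPzRingType) m n (s : 'S_n) (a : 'rV[K]_n) :
  Vandermonde m (col_perm s a) = col_perm s (Vandermonde m a).
Proof. by apply/matrixP => i j; rewrite !mxE. Qed.

(* Compare the signs of the Vandermonde determinants of (0, ..., n - 1) and of
   its permutation by [w^-1]: each inversion flips one factor. *)
Lemma odd_perm_length n (w : 'S_n) : odd (perm_length w) = w.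
Proof.
pose a : 'rV[int]_n := \row_j (j%:Z).
pose s := (w^-1)%g.
have sgV (t : 'S_n) : Num.sg (\det (Vandermonde n (col_perm t a))) =
    (-1) ^+ #|inversions (t^-1)%g|.
  rewrite det_Vandermonde pair_big_dep /= -prodr_const.
  rewrite big_mkcond [RHS]big_mkcond /=.
  rewrite (big_morph _ (@sgrM _) (@sgr1 _)); apply: eq_bigr => -[i j] _ /=.
  rewrite mem_inversions invgK /= !mxE; case: ltnP => //= ij.
  have tij : t i != t j by apply: contraTneq ij => /perm_inj ->; rewrite ltnn.
  case: ltnP => [lt_ji|le_ij]; first by rewrite ltr0_sg ?subr_lt0 ?ltz_nat.
  by rewrite gtr0_sg ?subr_gt0 ?ltz_nat // ltn_neqAle tij.
have inv1 : inversions (1%g : 'S_n) = set0.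
  apply/setP => p; rewrite mem_inversions invg1 !perm1 inE.
  by case: (ltngtP p.1 p.2).
have sg1 := sgV 1%g; rewrite col_perm1 invg1 inv1 cards0 expr0 in sg1.
(* Permuting columns multiplies the determinant by the sign of the permutation, and the unpermuted
   determinant is positive by [sg1]. *)
have := sgV s; rewrite Vandermonde_col_perm col_permE det_mulmx det_perm.
rewrite sgrM sg1 mul1r invgK -/(perm_length w).
by rewrite -[in RHS]signr_odd; case: (odd_perm w); case: (odd _).
Qed.

Lemma sum_ltn_ord n (i : 'I_n) : \sum_(j < n) (j < i)%:Z = i%:Z.
Proof.
transitivity (\sum_(j < n | (j < i)%N) (1 : int)).
  by rewrite [RHS]big_mkcond; apply: eq_bigr => j _; case: ifP.
rewrite -(big_ord_widen n (fun=> 1)) ?sumr_const ?card_ord -?natz //.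
exact: ltnW.
Qed.

(* The difference of the two inner sums counts the [b < a] minus the [b] with
   [w^-1 b < w^-1 a]: the [b] satisfying both cancel. *)
Lemma inversions_balance n (w : 'S_n) (a : 'I_n) :
  \sum_b ((b, a) \in inversions w)%:Z - \sum_b ((a, b) \in inversions w)%:Z =
  a%:Z - ((w^-1)%g a)%:Z.
Proof.
set v := (w^-1)%g.
rewrite -[in RHS](@sum_ltn_ord n a) -(@sum_ltn_ord n (v a)).
(* Each index below [v a] is written as [v b], so that both counts run over the same [b]. *)
rewrite [X in _ = _ - X](reindex_inj (@perm_inj _ v)) /= -!sumrB.
apply: eq_bigr => b _; rewrite !mem_inversions /= -/v.
have [->|/eqP ab] := eqVneq a b; first by rewrite !ltnn.
have /eqP vab : v a <> v b by move/perm_inj.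
move/eqP: ab; move: vab; rewrite -!val_eqE /=.
by case: (ltngtP a b); case: (ltngtP (v a) (v b)).
Qed.

Lemma sqrz_absz (m : int) : (`|m| ^ 2)%N%:Z = m ^+ 2.
Proof. by rewrite -abszX abszE normrX real_normK ?num_real. Qed.

Lemma double_bigrassmannian_stat n (w : 'S_n) :
  ((bigrassmannian_stat w).*2 = \sum_(i < n) `|i - (w^-1)%g i| ^ 2)%N.
Proof.
set v := (w^-1)%g; apply/eqP; rewrite -eqz_nat; apply/eqP.
have statE : (bigrassmannian_stat w)%:Z = \sum_(i < n) i%:Z * (i%:Z - (v i)%:Z).
  transitivity (\sum_(i < n) \sum_(j < n)
                   ((i, j) \in inversions w)%:Z * (j%:Z - i%:Z)).
    rewrite pair_big /= /bigrassmannian_stat -natz natr_sum big_mkcond /=.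
    apply: eq_bigr => -[i j] _ /=.
    case: ifP => [|_]; last by rewrite mul0r.
    by rewrite mem_inversions => /andP[/= ij _]; rewrite mul1r natz subzn // ltnW.
  under eq_bigr do under eq_bigr do rewrite mulrBr.
  under eq_bigr do rewrite sumrB.
  (* The swap groups the positive terms by the larger entry of the inversion, the negative ones
     being grouped by the smaller. *)
  rewrite sumrB [X in X - _]exchange_big /= -sumrB; apply: eq_bigr => i _.
  by rewrite -inversions_balance mulrBr -!mulr_suml ![_ * i%:Z]mulrC.
have sqv : \sum_i (v i)%:Z ^+ 2 = \sum_(i < n) i%:Z ^+ 2.
  by rewrite [RHS](reindex_inj (@perm_inj _ v)).
rewrite -addnn PoszD statE -[in RHS]natz natr_sum.
under [RHS]eq_bigr do rewrite natz sqrz_absz.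
(* Adding this zero makes the two sides agree term by term: [2 i (i - v i) = (i - v i)^2 + i^2 - (v
   i)^2]. *)
have -> : \sum_(i < n) (i%:Z - (v i)%:Z) ^+ 2 =
    \sum_(i < n) (i%:Z - (v i)%:Z) ^+ 2
    + (\sum_(i < n) i%:Z ^+ 2 - \sum_i (v i)%:Z ^+ 2).
  by rewrite sqv subrr addr0.
by rewrite -sumrB -!big_split /=; apply: eq_bigr => i _; ring.
Qed.

(** With [x] in the role of [q^(1/2)] all exponents are natural numbers, so the identity makes sense
    over any commutative ring. *)
Lemma signed_bigrassmannian_det (K : comNzRingType) n (x : K) :
  signed_bigrassmannian n (x ^+ 2) =
  \det (\matrix_(i < n, j < n) x ^+ (`|i - j| ^ 2)%N).
Proof.
rewrite /signed_bigrassmannian /determinant (reindex_inj invg_inj) /=.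
apply: eq_bigr => s _; rewrite -signr_odd odd_perm_length odd_permV -exprM mul2n.
rewrite double_bigrassmannian_stat invgK expr_sum; congr (_ * _).
by apply: eq_bigr => i _; rewrite mxE.
Qed.

Theorem theorem4p4 (R : realType) (n : nat) (hn : (0 < n)%N) :
  signed_bigrassmannian n (q R) =
  \det (\matrix_(i < n, j < n) qpow_half R ((i%:Z - j%:Z) ^+ 2)).
Proof.
rewrite signed_bigrassmannian_det; congr (\det _); apply/matrixP => i j.
by rewrite !mxE /qpow_half -sqrz_absz.
Qed.
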